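(* Let $(\mathcal{N},\mathcal{I})$ be a matroid with $|\mathcal{N}|=n$ and rank $r$, and let $f:2^{\mathcal{N}}\to\mathbb{R}$ be a non-monotone, non-negative submodular function. Then the algorithm TwinGreedy (described in the context), run on $(\mathcal{N},\mathcal{I},f)$, returns a solution $S^*$ with $\frac14$ approximation ratio for the problem $\max\{f(S):S\in\mathcal{I}\}$, i.e. $S^*\in\mathcal{I}$ and $f(S^* )\ge \frac14\max\{f(S):S\in\mathcal{I}\}$, under time complexity of $\mathcal{O}(nr)$.
   Context: Submodular: $f(X)+f(Y)\ge f(X\cup Y)+f(X\cap Y)$ for all $X,Y\subseteq\mathcal{N}$. Non-negative: $f(X)\ge 0$ for all $X\subseteq\mathcal{N}$. Non-monotone: there exist $X\subset Y\subseteq\mathcal{N}$ with $f(X)>f(Y)$. Marginal gain: $f(X\mid Y)=f(X\cup Y)-f(Y)$, and $f(x\mid Y)=f(\{x\}\mid Y)$ for $x\in\mathcal{N}$. A matroid $(\mathcal{N},\mathcal{I})$ consists of a finite ground set $\mathcal{N}$ and a family $\mathcal{I}\subseteq 2^{\mathcal{N}}$ of independent sets such that: $\emptyset\in\mathcal{I}$; if $A\subseteq B\in\mathcal{I}$ then $A\in\mathcal{I}$; and if $A,B\in\mathcal{I}$ with $|A|<|B|$, then there exists $x\in B\setminus A$ with $A\cup\{x\}\in\mathcal{I}$. Its rank is $r=\max\{|S|:S\in\mathcal{I}\}$. Algorithm TwinGreedy: start with $S_1=S_2=\emptyset$. Repeat the following. For $j\in\{1,2\}$ let $\mathcal{M}_j=\{e\in\mathcal{N}\setminus(S_1\cup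 S_2): S_j\cup\{e\}\in\mathcal{I}\}$. If $\mathcal{M}_1\cup\mathcal{M}_2=\emptyset$, stop the loop. Otherwise choose a pair $(i,e)$ maximizing $f(u\mid S_j)$ over all pairs $(j,u)$ with $j\in\{1,2\}$, $u\in\mathcal{M}_j$ (ties broken arbitrarily); if $f(e\mid S_i)\le 0$, stop the loop; otherwise replace $S_i$ by $S_i\cup\{e\}$ and continue. When the loop has stopped, return $S^*\in\arg\max_{X\in\{S_1,S_2\}}f(X)$. *)

(* Defs.v *)
From mathcomp Require Import all_boot all_order all_algebra.
From mathcomp Require Import reals.

Set Implicit Arguments.
Unset Strict Implicit.
Unset Printing Implicit Defensive.

Import Order.TTheory GRing.Theory Num.Theory.
Local Open Scope ring_scope.

Record matroid (T : finType) := Matroid {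
  indep : {set {set T}};
  indep0 : set0 \in indep;
  indepS : forall A B : {set T}, A \subset B -> B \in indep -> A \in indep;
  indep_exchange : forall A B : {set T}, A \in indep -> B \in indep ->
    (#|A| < #|B|)%N -> exists2 x, x \in B :\: A & A :|: [set x] \in indep
}.

Definition rank (T : finType) (M : matroid T) : nat :=
  (\max_(S in indep M) #|S|)%N.

Section SetFunctions.
Variables (R : realType) (T : finType).
Implicit Types f : {set T} -> R.

Definition submodular f := forall X Y : {set T},
  f X + f Y >= f (X :|: Y) + f (X :&: Y).

Definition nonnegative f := forall X : {set T}, 0 <= f X.

Definition non_monotone f := exists X Y : {set T}, X \proper Y /\ f X > f Y.

(* Since set0 is independent, the default value f set0 does not change the
   maximum. *)
Definition max_indep (M : matroid T) f : R :=
  \big[Num.max/f set0]_(S in indep M) f S.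

End SetFunctions.

(* A nondeterministic computation with result in A, given by the set of its
   executions: [m t a] means that some execution of m takes time t and returns
   a. Time counts the queries to the two oracles (value of f, independence)
   and the elementary steps charged by [tick] and [pick_max]. *)
Definition timed (A : Type) := nat -> A -> Prop.

Definition ret (A : Type) (a : A) : timed A := fun t x => t = 0%N /\ x = a.

Definition bind (A B : Type) (m : timed A) (k : A -> timed B) : timed B :=
  fun t b => exists t1 t2 a, [/\ m t1 a, k a t2 b & t = (t1 + t2)%N].

Notation "'let*' x := m 'in' k" := (bind m (fun x => k))
  (at level 200, x name, m at level 100, k at level 200).

Definition tick (c : nat) : timed unit := fun t _ => t = c.

Definition ask_indep (T : finType) (M : matroid T) (S : {set T}) : timed bool :=
  fun t b => t = 1%N /\ b = (S \in indep M).

Definition ask_value (R : realType) (T : finType) (f : {set T} -> R)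
    (S : {set T}) : timed R :=
  fun t v => t = 1%N /\ v = f S.

(* Any entry of s with largest second component: ties are broken arbitrarily.
   There is no execution when s is empty. *)
Definition pick_max (R : realType) (A : eqType) (s : seq (A * R)) :
    timed (A * R) :=
  fun t x => [/\ t = size s, x \in s & forall y, y \in s -> y.2 <= x.2].

Fixpoint timed_filter (A : Type) (p : A -> timed bool) (s : seq A) :
    timed (seq A) :=
  if s is x :: s' then
    let* b := p x in
    let* l := timed_filter p s' in
    ret (if b then x :: l else l)
  else ret [::].

Fixpoint timed_map (A B : Type) (g : A -> timed B) (s : seq A) :
    timed (seq B) :=
  if s is x :: s' then
    let* y := g x in
    let* l := timed_map g s' in
    ret (y :: l)
  else ret [::].

(* In the body of a loop, [inl a] continues with the new loop state a and
   [inr b] leaves the loop with result b. *)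
Inductive loop (A B : Type) (body : A -> timed (A + B)%type) (a : A) :
    timed B :=
| loop_exit t b of body a t (inr b) : loop body a t b
| loop_next t1 a' t2 b of
    body a t1 (inl a') & loop body a' t2 b : loop body a (t1 + t2)%N b.

(* No execution of the loop started in state a gets stuck at the beginning of
   an iteration or iterates forever. *)
Inductive loop_terminates (A B : Type) (body : A -> timed (A + B)%type)
    (a : A) : Prop :=
| LoopTerminates of (exists t x, body a t x) &
    (forall t a', body a t (inl a') -> loop_terminates body a').

Section TwinGreedy.
Variables (R : realType) (T : finType) (M : matroid T) (f : {set T} -> R).

(* The pair (S_1, S_2). The indices 1 and 2 are encoded as false and true. *)
Definition twins := ({set T} * {set T})%type.

Definition twin (S : twins) (j : bool) : {set T} := if j then S.2 else S.1.

Definition insert_twin (S : twins) (j : bool) (e : T) : twins :=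
  if j then (S.1, S.2 :|: [set e]) else (S.1 :|: [set e], S.2).

(* The set M_j, as a list of its elements. *)
Definition extensions (S : twins) (j : bool) : timed (seq T) :=
  let* _ := tick #|T| in
  timed_filter (fun e => ask_indep M (twin S j :|: [set e]))
    (enum (~: (S.1 :|: S.2))).

(* f(u | Y) = f({u} U Y) - f(Y) *)
Definition marginal (u : T) (Y : {set T}) : timed R :=
  let* a := ask_value f ([set u] :|: Y) in
  let* b := ask_value f Y in
  let* _ := tick 1 in
  ret (a - b).

Definition twin_greedy_body (S : twins) : timed (twins + twins)%type :=
  let* M1 := extensions S false in
  let* M2 := extensions S true in
  let pairs := [seq (false, u) | u <- M1] ++ [seq (true, u) | u <- M2] in
  let* _ := tick 1 in
  if pairs is [::] then ret (inr S) else
  let* gains := timed_map (fun ju : bool * T =>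
      let* g := marginal ju.2 (twin S ju.1) in ret (ju, g)) pairs in
  let* best := pick_max gains in
  let* _ := tick 1 in
  if best.2 <= 0 then ret (inr S) else
  let* _ := tick 1 in
  ret (inl (insert_twin S best.1.1 best.1.2)).

Definition start : twins := (set0, set0).

Definition twin_greedy : timed {set T} :=
  let* S := loop twin_greedy_body start in
  let* v1 := ask_value f S.1 in
  let* v2 := ask_value f S.2 in
  let* best := pick_max [:: (S.1, v1); (S.2, v2)] in
  ret best.1.

End TwinGreedy.

(* Main.v *)
(** Let [O] be independent and let [S_1], [S_2] be the final twins. As they are
disjoint, submodularity gives [f O <= f (O U S_1) + f (O U S_2)], so it is enough
to bound the gains [f(o | S_j)], for [o] in [O \ S_j], by the total
[sum_j (f S_j - f set0)] of the gains collected by the algorithm. An element [o]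
that could still extend [S_j] when it was put in the other twin is paid for by
its own insertion. An element that was blocked earlier is paid for by an
element of [S_j \ O] inserted before, when [o] was still a candidate for [S_j];
by the exchange property there are at all times at least as many elements in
[S_j \ O] as blocked elements of [O], and the greedy gains only decrease, so
instead of an explicit matching it suffices to remember the number of unspent
elements of [S_j \ O], each worth at least the current maximal gain. *)

Require Import Defs.
From mathcomp Require Import all_boot all_order all_algebra.
From mathcomp Require Import reals.
From mathcomp Require Import zify ring lra.

Set Implicit Arguments.
Unset Strict Implicit.
Unset Printing Implicit Defensive.

Import Order.TTheory GRing.Theory Num.Theory.
Local Open Scope ring_scope.

(** * Timed computations with a single execution *)

(** Within an iteration only [pick_max] involves a choice; every other step has one cost and one
    result. *)
Definition costs (A : Type) (m : timed A) (c : nat) (a : A) : Prop :=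
  forall t b, m t b <-> t = c /\ b = a.

Lemma costs_ret (A : Type) (a : A) : costs (ret a) 0 a.
Proof. by []. Qed.

Lemma costs_tick (c : nat) : costs (tick c) c tt.
Proof. by move=> t [] /=; split=> [->|[-> _]]. Qed.

Lemma bind_costsE (A B : Type) (m : timed A) (k : A -> timed B) c a t b :
  costs m c a ->
  bind m k t b <-> exists2 t', k a t' b & t = (c + t')%N.
Proof.
move=> mc; split=> [[t1 [t2 [x [/mc[-> ->] kb ->]]]]|[t' kb ->]].
  by exists t2.
by exists c, t', a; split=> //; apply/mc.
Qed.

Lemma costs_bind (A B : Type) (m : timed A) (k : A -> timed B) c a c' b :
  costs m c a -> costs (k a) c' b -> costs (bind m k) (c + c')%N b.
Proof.
move=> mc kc t x; split=> [/(bind_costsE _ _ _ mc)[t' /kc[-> ->] ->] //|[-> ->]].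
by apply/(bind_costsE _ _ _ mc); exists c' => //; apply/kc.
Qed.

Definition executable (A : Type) (m : timed A) : Prop := exists t a, m t a.

Lemma executable_bind (A B : Type) (m : timed A) (k : A -> timed B) c a :
  costs m c a -> executable (k a) -> executable (bind m k).
Proof.
move=> mc [t [b kb]]; exists (c + t)%N, b.
by apply/(bind_costsE _ _ _ mc); exists t.
Qed.

Lemma costs_timed_filter (A : Type) (p : A -> timed bool) c (q : pred A) s :
  (forall x, costs (p x) c (q x)) ->
  costs (timed_filter p s) (c * size s)%N (filter q s).
Proof.
move=> pc; elim: s => [|x s IHs] /=; first by rewrite muln0.
rewrite mulnS -[(c * size s)%N]addn0.
apply: (costs_bind (pc x)); apply: (costs_bind IHs); exact: costs_ret.
Qed.

Lemma costs_timed_map (A B : Type) (g : A -> timed B) c (h : A -> B) s :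
  (forall x, costs (g x) c (h x)) ->
  costs (timed_map g s) (c * size s)%N (map h s).
Proof.
move=> gc; elim: s => [|x s IHs] /=; first by rewrite muln0.
rewrite mulnS -[(c * size s)%N]addn0.
apply: (costs_bind (gc x)); apply: (costs_bind IHs); exact: costs_ret.
Qed.

Lemma pick_max_total (R : realType) (A : eqType) (s : seq (A * R)) :
  s != [::] -> executable (pick_max s).
Proof.
case: s => // x s _.
suff [y ys ymax] : exists2 y, y \in x :: s & forall z, z \in x :: s -> z.2 <= y.2.
  by exists (size (x :: s)), y.
elim: s x => [|y s IHs] x.
  by exists x => [|z]; rewrite inE // => /eqP ->.
have [z zs zmax] := IHs y.
have [xz|zx] := leP x.2 z.2.
  exists z => [|w]; first by rewrite inE zs orbT.
  by rewrite inE => /predU1P[->|/zmax].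
exists x => [|w]; first exact: mem_head.
by rewrite inE => /predU1P[->|/zmax wz] //; apply: le_trans wz (ltW zx).
Qed.

(** * Loops: existence of executions, invariants, running time *)

Lemma loop_exists (A B : Type) (body : A -> timed (A + B)%type) a :
  loop_terminates body a -> executable (loop body a).
Proof.
elim=> {}a [t [[a'|b] abody]] _ IHa.
  have [t' [b a'b]] := IHa _ _ abody.
  by exists (t + t')%N, b; apply: loop_next abody a'b.
by exists t, b; apply: loop_exit.
Qed.

Section LoopInvariants.
Variables (A B : Type) (body : A -> timed (A + B)%type) (P : A -> Prop).
Hypothesis P_step : forall a t a', P a -> body a t (inl a') -> P a'.

Lemma loop_invariant a t b :
  P a -> loop body a t b -> exists2 a', P a' & exists t', body a' t' (inr b).
Proof.
move=> + ab; elim: ab => {a t b} [a t b ab Pa|a t1 a' t2 b aa' _ IHa Pa].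
  by exists a => //; exists t.
exact/IHa/(P_step Pa aa').
Qed.

(** [mu] bounds the number of continuing iterations; the extra one is the iteration that exits. *)
Lemma loop_time (mu : A -> nat) (K : nat) a t b :
  (forall a t r, body a t r -> (t <= K)%N) ->
  (forall a t a', P a -> body a t (inl a') -> (mu a' < mu a)%N) ->
  P a -> loop body a t b -> (t <= K * (mu a).+1)%N.
Proof.
move=> leK ltmu + ab.
elim: ab => {a t b} [a t b /leK tK _|a t1 a' t2 b aa' _ IHa Pa].
  by apply: leq_trans tK _; rewrite leq_pmulr.
rewrite mulnS leq_add ?(leK _ _ _ aa') //.
apply: leq_trans (IHa (P_step Pa aa')) _.
by rewrite leq_mul2l (ltmu _ _ _ Pa aa') orbT.
Qed.

End LoopInvariants.

(** * Diminishing returns and matroid exchange *)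

Section SubmodularGains.
Variables (R : realType) (T : finType) (f : {set T} -> R).
Hypothesis f_sub : submodular f.
Implicit Types (u : T) (X Y : {set T}).

Definition gain u Y : R := f (u |: Y) - f Y.

(** Submodularity for [u |: X] and [Y], which meet in [X] because [u] is outside [Y]. For [u] in [Y]
    the left side would be 0, while [gain u X] may be negative. *)
Lemma gain_anti u X Y : X \subset Y -> u \notin Y -> gain u Y <= gain u X.
Proof.
move=> sXY uY; rewrite /gain.
have -> : u |: Y = (u |: X) :|: Y by rewrite -setUA (setUidPr sXY).
have /setIidPl eX := sXY.
have := f_sub (u |: X) Y; rewrite setIUl eX.
have -> : [set u] :&: Y = set0.
  by apply/setP=> x; rewrite !inE; apply: contraNF uY => /andP[/eqP <-].
by rewrite set0U; lra.
Qed.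

(** Induction removing some [u] from [X]: if [u] is in [Y], its gain is 0 and the union is
    unchanged; otherwise adding it to [X :\ u :|: Y] gains at most [gain u Y]. *)
Lemma union_le_sum_gain X Y : f (X :|: Y) - f Y <= \sum_(u in X) gain u Y.
Proof.
have [n] := ubnP #|X|; elim: n X => // n IHn X ltXn.
have [->|[u uX]] := set_0Vmem X; first by rewrite big_set0 set0U subrr.
have ltX'n : (#|X :\ u| < n)%N by have := cardsD1 u X; rewrite uX; lia.
rewrite (big_setD1 u) //=; have := IHn _ ltX'n.
have [uY|uY] := boolP (u \in Y).
  have -> : gain u Y = 0 by rewrite /gain (setUidPr _) ?sub1set // subrr.
  have -> : X :\ u :|: Y = X :|: Y; last by rewrite add0r.
  by apply/setP=> x; rewrite !inE; case: eqP => // ->; rewrite uY !orbT.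
have := @gain_anti u Y (X :\ u :|: Y); rewrite subsetUr !inE eqxx /= => /(_ isT uY).
rewrite {1}/gain setUA setD1K //; lra.
Qed.

Lemma sum_gain_anti X Y (A : {set T}) : X \subset Y -> [disjoint A & Y] ->
  \sum_(u in A) gain u Y <= \sum_(u in A) gain u X.
Proof.
move=> sXY dAY; apply: ler_sum => u uA.
by apply: gain_anti => //; rewrite (disjointFr dAY).
Qed.

End SubmodularGains.

(** If the independent set [B :|: S :&: O] were larger than [S], exchange would extend [S] by an
    element of [B], which is blocked. Cancelling [S :&: O] on both sides gives the bound. It makes
    the number of unspent elements non-negative. *)
Lemma card_blocked (T : finType) (M : matroid T) (S O B : {set T}) :
  S \in indep M -> O \in indep M -> B \subset O :\: S ->
  (forall o, o \in B -> S :|: [set o] \notin indep M) ->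
  (#|B| <= #|S :\: O|)%N.
Proof.
move=> iS iO sB blocked.
have iA : B :|: S :&: O \in indep M.
  apply: indepS iO; rewrite subUset subsetIr andbT.
  exact: subset_trans sB (subsetDl _ _).
have dis : B :&: (S :&: O) = set0.
  apply/setP=> x; rewrite !inE; apply/negP=> /and3P[/(subsetP sB)].
  by rewrite inE => /andP[/negP].
have : (#|B :|: S :&: O| <= #|S|)%N.
  rewrite leqNgt; apply/negP=> /(indep_exchange iS iA)[x].
  rewrite !inE => /andP[/negbTE xS]; rewrite xS orbF => /blocked /negP.
  by move=> + h.
have := cardsUI B (S :&: O); have := cardsID O S; rewrite dis cards0; lia.
Qed.

(** * One iteration of the algorithm *)

Section Body.
Variables (R : realType) (T : finType) (M : matroid T) (f : {set T} -> R).
Implicit Types (S : twins T) (j : bool) (u e : T).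

Definition available S j u : bool :=
  (u \in ~: (S.1 :|: S.2)) && (twin S j :|: [set u] \in indep M).

Definition greedy S j e : Prop :=
  [/\ available S j e, 0 < gain f e (twin S j)
    & forall k u, available S k u -> gain f u (twin S k) <= gain f e (twin S j)].

(** Spelled as [pairs] in [twin_greedy_body] with the results of [extensions] filled in, so that it
    can be folded there. *)
Definition candidates S : seq (bool * T) :=
  [seq (false, u) | u <- enum (~: (S.1 :|: S.2)) & twin S false :|: [set u] \in indep M] ++
  [seq (true, u) | u <- enum (~: (S.1 :|: S.2)) & twin S true :|: [set u] \in indep M].

Lemma mem_candidates S j u : ((j, u) \in candidates S) = available S j u.
Proof.
rewrite mem_cat /available -[u \in ~: _]mem_enum andbC.
have memN k l (s : seq T) : ((k, u) \in [seq (l, x) | x <- s]) = (k == l) && (u \in s).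
  apply/mapP/andP=> [[x xs [-> ->]]|[/eqP -> us]]; first by rewrite eqxx.
  by exists u.
by rewrite !memN !mem_filter; case: j; rewrite ?orbF.
Qed.

Lemma size_candidates S : (size (candidates S) <= 2 * #|T|)%N.
Proof.
rewrite size_cat !size_map !size_filter mul2n -addnn.
by apply: leq_add; rewrite (leq_trans (count_size _ _)) // -cardE max_card.
Qed.

Lemma costs_extensions S j :
  costs (extensions M S j) (#|T| + #|~: (S.1 :|: S.2)|)
    [seq u <- enum (~: (S.1 :|: S.2)) | twin S j :|: [set u] \in indep M].
Proof.
apply: costs_bind (costs_tick _) _; rewrite -[#|~: _|]mul1n cardE.
exact: costs_timed_filter.
Qed.

Lemma costs_marginal u (Y : {set T}) : costs (marginal f u Y) 3 (gain f u Y).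
Proof.
have askc Z : costs (ask_value f Z) 1 (f Z) by [].
apply: (costs_bind (askc _) (c' := 2)); apply: (costs_bind (askc _) (c' := 1)).
by apply: (costs_bind (costs_tick 1) (c' := 0)); apply: costs_ret.
Qed.

Lemma costs_gains S (s : seq (bool * T)) :
  costs (timed_map (fun ju : bool * T =>
      let* g := marginal f ju.2 (twin S ju.1) in ret (ju, g)) s)
    (3 * size s) [seq (ju, gain f ju.2 (twin S ju.1)) | ju <- s].
Proof.
apply: costs_timed_map => ju.
by apply: (@costs_bind _ _ _ _ 3 _ 0); [exact: costs_marginal|exact: costs_ret].
Qed.

Lemma executable_body S : executable (twin_greedy_body M f S).
Proof.
apply: executable_bind (costs_extensions S false) _.
apply: executable_bind (costs_extensions S true) _.
apply: executable_bind (costs_tick 1) _; rewrite -/(candidates S).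
case Ec: (candidates S) => [|p s]; first by exists 0%N, (inr S).
apply: executable_bind (costs_gains S _) _.
have [t [best pick]] := @pick_max_total _ _
  [seq (ju, gain f ju.2 (twin S ju.1)) | ju <- p :: s] isT.
suff [t' [r kr]] : executable (let* _ := tick 1 in
    if best.2 <= 0 then ret (inr S) else
    let* _ := tick 1 in
    ret (inl (insert_twin S best.1.1 best.1.2)) : timed (twins T + twins T)).
  by exists (t + t')%N, r, t, t', best.
apply: executable_bind (costs_tick 1) _.
case: (best.2 <= 0); first by exists 0%N, (inr S).
by apply: executable_bind (costs_tick 1) _; exists 0%N; eexists.
Qed.

(** Writing n for [#|T|], the two calls of [extensions] cost at most 4n; the at most 2n candidates
    cost 3 each for their gains and 1 each in [pick_max]; at most three ticks remain. *)
Lemma body_spec S t r : twin_greedy_body M f S t r ->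
  (t <= 12 * #|T| + 3)%N /\
  match r with
  | inr S' => S' = S /\ forall j u, available S j u -> gain f u (twin S j) <= 0
  | inl S' => exists j e, greedy S j e /\ S' = insert_twin S j e
  end.
Proof.
move/(bind_costsE _ _ _ (costs_extensions S false))=> [t1].
move/(bind_costsE _ _ _ (costs_extensions S true))=> [t2].
rewrite -/(candidates S).
move/(bind_costsE _ _ _ (costs_tick 1))=> [t3].
have lec := size_candidates S.
have leX : (#|~: (S.1 :|: S.2)| <= #|T|)%N by apply: max_card.
move: lec leX; set n := #|T| => lec leX.
case Ec: (candidates S) => [|p s].
  move=> [-> ->] -> -> ->; split; first lia.
  by split=> // j u; rewrite -mem_candidates Ec.
rewrite -Ec.
move/(bind_costsE _ _ _ (costs_gains S _))=> [t4].
move=> [t5 [t6 [[[j e] g] [[-> bestc bestmax]]]]].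
rewrite size_map; move: lec; set c := size (candidates S) => lec.
move/(bind_costsE _ _ _ (costs_tick 1))=> [t7 /= +] -> -> -> -> ->.
have gmax k u : available S k u -> gain f u (twin S k) <= g.
  rewrite -mem_candidates => kuc; apply: (bestmax ((k, u), _)).
  by apply/mapP; exists (k, u).
case/mapP: bestc => -[j' e'] jec [eqj eqe eqg]; subst j' e' g.
case: leP => [g_le0 [-> ->] ->|g_gt0].
  split; first lia.
  by split=> // k u kua; apply: le_trans (gmax k u kua) _.
move/(bind_costsE _ _ _ (costs_tick 1))=> [t8 [-> ->] ->]; split; first lia.
by exists j, e; split=> //; split=> //; rewrite -mem_candidates.
Qed.

End Body.

(** * Feasibility of the twins and termination *)

Section Twins.
Variable T : finType.
Implicit Types (S : twins T) (i j : bool) (e : T).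

Lemma twin_insert S i e j :
  twin (insert_twin S i e) j = if j == i then twin S i :|: [set e] else twin S j.
Proof. by case: i; case: j. Qed.

Lemma sum_twins (R : realType) (F : bool -> R) i : \sum_j F j = F i + F (~~ i).
Proof. by rewrite big_bool; case: i; rewrite // addrC. Qed.

Lemma twinsU S i : S.1 :|: S.2 = twin S i :|: twin S (~~ i).
Proof. by case: i; rewrite // setUC. Qed.

End Twins.

Section Feasible.
Variables (T : finType) (M : matroid T).
Implicit Types (S : twins T) (i j : bool) (e u : T).

Lemma availableE S j u : available M S j u =
  [&& u \notin twin S j, u \notin twin S (~~ j) & twin S j :|: [set u] \in indep M].
Proof. by rewrite /available (twinsU S j) !inE negb_or andbA. Qed.

Definition feasible S : Prop :=
  (forall j, twin S j \in indep M) /\ (forall j, [disjoint twin S j & twin S (~~ j)]).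

Lemma feasible_start : feasible (start T).
Proof.
by split=> -[]; rewrite /= ?indep0 // -setI_eq0 setI0.
Qed.

Lemma feasible_insert S j e :
  feasible S -> available M S j e -> feasible (insert_twin S j e).
Proof.
move=> [iS dS]; rewrite availableE => /and3P[_ eN iX]; split=> k.
  by rewrite twin_insert; case: eqP.
have dX : [disjoint twin S j :|: [set e] & twin S (~~ j)].
  by rewrite -setI_eq0 setIUl setU_eq0 !setI_eq0 dS disjoints1.
rewrite !twin_insert; case: (eqVneq k j) => [->|]; first by case: (j) dX.
by case: k; case: j dX {eN iX} => //= dX _; rewrite disjoint_sym.
Qed.

Lemma card_insert_twins S j e : available M S j e ->
  let S' := insert_twin S j e in #|S'.1 :|: S'.2| = (#|S.1 :|: S.2|).+1.
Proof.
move=> /andP[eS _] /=.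
suff -> : (insert_twin S j e).1 :|: (insert_twin S j e).2 = e |: (S.1 :|: S.2).
  by rewrite cardsU1 -in_setC eS.
by case: (j); apply/setP=> x; rewrite !inE /=;
  case: (x \in S.1); case: (x \in S.2); case: (x == e).
Qed.

Lemma card_feasible S : feasible S -> (#|S.1 :|: S.2| <= 2 * rank M)%N.
Proof.
move=> [iS _]; rewrite (leq_trans (leq_card_setU _ _)) // mul2n -addnn.
by apply: leq_add; apply: leq_bigmax_cond; [exact: (iS false)|exact: (iS true)].
Qed.

End Feasible.

Lemma body_terminates (R : realType) (T : finType) (M : matroid T)
    (f : {set T} -> R) (S : twins T) :
  loop_terminates (twin_greedy_body M f) S.
Proof.
have [n] := ubnP #|~: (S.1 :|: S.2)|; elim: n S => [|n IHn] S ltSn.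
  by rewrite ltn0 in ltSn.
apply: LoopTerminates; first exact: executable_body.
move=> t S' /body_spec[_ [j [e [[ea _ _] ->]]]]; apply: IHn.
have := cardsC (S.1 :|: S.2).
have := cardsC ((insert_twin S j e).1 :|: (insert_twin S j e).2).
rewrite (card_insert_twins ea); lia.
Qed.

(** * The charging invariant *)

Section Charging.
Variables (R : realType) (T : finType) (M : matroid T) (f : {set T} -> R).
Hypothesis f_sub : submodular f.
Variable O : {set T}.
Hypothesis O_indep : O \in indep M.
Implicit Types (S : twins T) (B : bool -> {set T}) (d : R).

(* [B j] is the set of elements of [O] blocked by [twin S j], except those already
   in the other twin when they became blocked; [d] bounds the current gains, and
   [#|twin S j :\: O| - #|B j|] is the number of unspent elements. *)
Record charging S B d : Prop := Charging {
  charging_feasible : feasible M S;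
  charging_sub : forall j, B j \subset O :\: twin S j;
  charging_blocked :
    forall j o, o \in B j -> twin S j :|: [set o] \notin indep M;
  charging_cover : forall j o, o \in O ->
    [|| o \in twin S j, o \in twin S (~~ j), o \in B j | available M S j o];
  charging_max : forall j u, available M S j u -> gain f u (twin S j) <= d;
  charging_ge0 : 0 <= d;
  charging_sum :
    \sum_(j : bool) (\sum_(o in B j :|: O :&: twin S (~~ j)) gain f o (twin S j)
                     + (#|twin S j :\: O|%:R - #|B j|%:R) * d)
    <= \sum_(j : bool) (f (twin S j) - f set0) }.

(** Nothing is blocked or unspent yet, so [d] has coefficient 0 in [charging_sum] and any upper
    bound on the initial gains will do. *)
Lemma charging_start :
  nonnegative f -> charging (start T) (fun=> set0) (\sum_(X : {set T}) f X).
Proof.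
move=> f_ge0.
have ts j : twin (start T) j = set0 by case: j.
split.
- exact: feasible_start.
- by move=> j; exact: sub0set.
- by move=> j o; rewrite inE.
- move=> j o oO; rewrite availableE !ts !inE /= set0U.
  by apply: indepS O_indep; rewrite sub1set.
- move=> j u _; rewrite ts /gain (bigD1 (u |: set0)) //=.
  by rewrite lerD // (le_trans (y := 0)) ?oppr_le0 ?f_ge0 // sumr_ge0.
- by rewrite sumr_ge0.
- rewrite !(sum_twins _ true) /= setI0 setU0 !big_set0 set0D !cards0.
  by rewrite !subrr !mul0r !addr0.
Qed.

(** The right side of [charging_sum] grows by the gain [g] of [e]. On the left, [e] accounts for at
    most [g]: as a new term for the other twin if it lies in [O], as a new unspent element
    otherwise. Each newly blocked element spends one unit worth [g], which covers its gain.
    Repricing the earlier unspent elements from [d] to [g] does not increase the left side. *)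
Lemma charging_step S B d j e : charging S B d -> greedy M f S j e ->
  exists B' d', charging (insert_twin S j e) B' d'.
Proof.
move=> [feas Bsub Bblocked cover dmax d_ge0 dsum] [ea g_gt0 gmax].
set X := twin S j; set Y := twin S (~~ j); set g := gain f e X.
have [iS dS] := feas.
have feas' := feasible_insert feas ea.
have := ea; rewrite availableE -/X -/Y => /and3P[eX eY iXe].
pose N := [set o in O | [&& available M S j o, o != e
                         & X :|: [set e] :|: [set o] \notin indep M]].
pose B' k := if k == j then B j :|: N else B k.
have twinN : twin (insert_twin S j e) (~~ j) = Y.
  by rewrite twin_insert /Y; case: (j).
have twinJ : twin (insert_twin S j e) j = X :|: [set e] by rewrite twin_insert eqxx.
have B'N : B' (~~ j) = B (~~ j) by rewrite /B'; case: (j).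
have B'J : B' j = B j :|: N by rewrite /B' eqxx.
have twinP (P : bool -> Prop) : P j -> P (~~ j) -> forall k, P k.
  by case: (j) => ? ? [].
have eB : e \notin B j by apply/negP=> /Bblocked; rewrite iXe.
exists B', g; split=> //.
- apply: twinP; last by rewrite B'N twinN.
  rewrite B'J twinJ; apply/subsetP=> o; rewrite !inE => /orP[oB|].
    have := subsetP (Bsub j) o oB; rewrite !inE -/X => /andP[/negbTE -> ->].
    by rewrite andbT /=; apply: contraNneq eB => <-.
  by rewrite availableE => /and4P[-> /and3P[/negbTE -> _ _] /negbTE -> _].
- apply: twinP; last by rewrite B'N twinN; exact: Bblocked.
  rewrite B'J twinJ => o; rewrite inE => /orP[/Bblocked|]; last first.
    by rewrite !inE => /and4P[].
  by apply: contra; apply: indepS; rewrite setUAC subsetUl.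
- apply: twinP => o oO; last first.
    have := cover (~~ j) o oO; rewrite !availableE negbK B'N twinN twinJ -/X -/Y.
    by rewrite !inE; case: (o \in X); case: (o \in Y); case: (o == e).
  have := cover j o oO; rewrite !availableE twinN twinJ -/X -/Y B'J !inE.
  rewrite oO availableE -/X -/Y /=.
  by case: (o \in X); case: (o \in Y); case: (o == e); case: (o \in B j);
    case: (X :|: [set o] \in indep M); case: (X :|: [set e] :|: [set o] \in indep M).
(* Whatever is still available was available before, so its old gain was at most [g], and gains only
   shrink. *)
- apply: twinP => u; last first.
    rewrite !availableE negbK twinN twinJ !inE negb_or.
    move=> /and3P[uY /andP[uX _] iYu].
    by apply: gmax; rewrite availableE negbK -/X -/Y uX uY.
  rewrite availableE twinN twinJ => /and3P[uXe uY iXu].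
  apply: le_trans (gain_anti f_sub (subsetUl X [set e]) uXe) _.
  apply: gmax; rewrite availableE uY -/X; move: uXe; rewrite inE negb_or => /andP[-> _].
  by apply: indepS iXu; rewrite setUAC subsetUl.
- exact: ltW.
move: dsum; rewrite !(sum_twins _ j) B'N B'J !negbK twinN twinJ -/X -/Y => dsum.
have g_le_d : g <= d by apply: dmax.
have dBN : [disjoint B j :|: O :&: Y & N].
  rewrite -setI_eq0; apply/eqP/setP=> o; rewrite !inE availableE -/X -/Y.
  apply/negP=> /andP[+ /and3P[_ /and3P[_ oY iXo] _]].
  by rewrite (negbTE oY) andbF orbF => /Bblocked; rewrite iXo.
have sumJ : \sum_(o in B j :|: N :|: O :&: Y) gain f o (X :|: [set e])
    <= \sum_(o in B j :|: O :&: Y) gain f o X + #|N|%:R * g.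
  have dBX : [disjoint B j :|: O :&: Y & X :|: [set e]].
    rewrite -setI_eq0; apply/eqP/setP=> o; rewrite !inE.
    apply/negP=> /andP[/orP[oB|/andP[_ oY]] /orP[oX|/eqP oe]].
    - by have := subsetP (Bsub j) o oB; rewrite !inE -/X oX.
    - by rewrite -oe oB in eB.
    - by have := disjointFr (dS j) oX; rewrite -/Y oY.
    - by rewrite -oe oY in eY.
  rewrite setUAC (eq_bigl [predU B j :|: O :&: Y & N]) => [|o]; last by rewrite !inE.
  rewrite bigU //= lerD ?sum_gain_anti ?subsetUl // mulr_natl -sumr_const.
  apply: ler_sum => o; rewrite !inE => /and4P[_ oa oe _].
  apply: le_trans (gmax _ _ oa); apply: gain_anti; rewrite ?subsetUl //.
  by move: oa; rewrite availableE !inE negb_or oe andbT => /and3P[].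
(* Only [e] can be a new term. Unless already blocked for the other twin, it was available there
   too, so its gain there is at most [g]. *)
have sumN : \sum_(o in B (~~ j) :|: O :&: (X :|: [set e])) gain f o Y
    <= \sum_(o in B (~~ j) :|: O :&: X) gain f o Y + (e \in O)%:R * g.
  case: (boolP (e \in O)) => eO; last first.
    have -> : O :&: (X :|: [set e]) = O :&: X; last by rewrite mul0r addr0.
    rewrite setIUr (eqP (_ : O :&: [set e] == set0)) ?setU0 //.
    by rewrite setI_eq0 disjoint_sym disjoints1.
  have -> : B (~~ j) :|: O :&: (X :|: [set e]) = e |: (B (~~ j) :|: O :&: X).
    by apply/setP=> x; rewrite !inE; case: eqP => [->|_]; rewrite ?eO ?orbT ?orbF.
  rewrite mul1r; have [eC|eC] := boolP (e \in B (~~ j) :|: O :&: X).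
    by rewrite (setUidPr _) ?sub1set // lerDl ltW.
  rewrite big_setU1 //= addrC lerD2l; apply: gmax.
  have := cover (~~ j) e eO; rewrite negbK -/X -/Y (negbTE eX) (negbTE eY) /=.
  by move: eC; rewrite inE negb_or => /andP[/negbTE -> _].
have cardX : (#|(X :|: [set e]) :\: O| + (e \in O) = #|X :\: O|.+1)%N.
  rewrite setDUl; have [eO|eO] := boolP (e \in O).
    by rewrite (eqP (_ : [set e] :\: O == set0)) ?setD_eq0 ?sub1set // setU0 addn1.
  have -> : [set e] :\: O = [set e] by apply/setDidPl; rewrite disjoints1.
  rewrite setUC cardsU1 !inE (negbTE eX) andbF.
  by rewrite addn0.
have cardB : #|B j :|: N| = (#|B j| + #|N|)%N.
  rewrite cardsU disjoint_setI0 ?cards0 ?subn0 //.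
  by apply: disjointWl dBN; exact: subsetUl.
have pJ : (#|B j| <= #|X :\: O|)%N := card_blocked (iS j) O_indep (Bsub j) (Bblocked j).
have pN : (#|B (~~ j)| <= #|Y :\: O|)%N.
  exact: card_blocked (iS (~~ j)) O_indep (Bsub (~~ j)) (Bblocked (~~ j)).
have cardXR : #|(X :|: [set e]) :\: O|%:R + (e \in O)%:R = #|X :\: O|%:R + 1 :> R.
  by rewrite -natrD cardX -natr1.
have fX : f (X :|: [set e]) = f X + g by rewrite /g /gain setUC; ring.
rewrite fX cardB natrD.
move: pJ pN; rewrite -!(ler_nat R) => pJ pN.
have : (#|X :\: O|%:R - #|B j|%:R) * g <= (#|X :\: O|%:R - #|B j|%:R) * d.
  by rewrite ler_wpM2l // subr_ge0.
have : (#|Y :\: O|%:R - #|B (~~ j)|%:R) * g <= (#|Y :\: O|%:R - #|B (~~ j)|%:R) * d.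
  by rewrite ler_wpM2l // subr_ge0.
have -> : #|(X :|: [set e]) :\: O|%:R = #|X :\: O|%:R + 1 - (e \in O)%:R :> R.
  by rewrite -cardXR addrK.
nra.
Qed.

(** Elements of [O] outside [S_j] that are missing from the sum are still available, so their gains
    are at most 0. Dropping the unspent rest, [charging_sum] bounds [f (O U S_1) + f (O U S_2)] by
    twice [f S_1 + f S_2]. The sets [O U S_j] meet exactly in [O], as the twins are disjoint. *)
Lemma charging_final S B d : charging S B d ->
  (forall j u, available M S j u -> gain f u (twin S j) <= 0) ->
  nonnegative f -> f O <= 2%:R * (f S.1 + f S.2).
Proof.
move=> [[iS dS] Bsub Bblocked cover _ d_ge0 dsum] stop f_ge0.
have bound j : f (O :|: twin S j) - f (twin S j) <=
    \sum_(o in B j :|: O :&: twin S (~~ j)) gain f o (twin S j)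
    + (#|twin S j :\: O|%:R - #|B j|%:R) * d.
  have -> : O :|: twin S j = O :\: twin S j :|: twin S j.
    by apply/setP=> x; rewrite !inE; case: (_ \in twin _ _); rewrite ?orbT ?orbF.
  apply: le_trans (union_le_sum_gain f_sub _ _) _.
  have p_ge0 : 0 <= (#|twin S j :\: O|%:R - #|B j|%:R) * d.
    by rewrite mulr_ge0 // subr_ge0 ler_nat; apply: card_blocked (Bsub j) (Bblocked j).
  rewrite -[leLHS]addr0 lerD //.
  have sC : B j :|: O :&: twin S (~~ j) \subset O :\: twin S j.
    rewrite subUset Bsub; apply/subsetP=> x; rewrite !inE => /andP[-> xN].
    by rewrite (disjointFl (dS j)).
  rewrite (big_setID (B j :|: O :&: twin S (~~ j))) /= (setIidPr sC) gerDl.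
  apply: sumr_le0 => o; rewrite !inE negb_or => /andP[/andP[oB oN] /andP[oX oO]].
  apply: stop; have := cover j o oO; rewrite (negbTE oX) (negbTE oB).
  by move: oN; rewrite oO /= => /negbTE ->.
have := f_sub (O :|: S.1) (O :|: S.2).
have -> : (O :|: S.1) :&: (O :|: S.2) = O.
  rewrite -setUIr; have /disjoint_setI0 /= -> := dS false; exact: setU0.
have := f_ge0 ((O :|: S.1) :|: (O :|: S.2)); have := f_ge0 set0.
have := bound false; have := bound true; move: dsum.
rewrite !(sum_twins _ true) /=; lra.
Qed.

End Charging.

(** * Approximation ratio and running time *)

Theorem theorem1 :
  exists C : nat,
  forall (R : realType) (T : finType) (M : matroid T) (f : {set T} -> R),
    non_monotone f -> nonnegative f -> submodular f ->
    [/\ loop_terminates (twin_greedy_body M f) (start T),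
        exists (t : nat) (S : {set T}), twin_greedy M f t S
      & forall (t : nat) (S : {set T}), twin_greedy M f t S ->
        [/\ S \in indep M,
            f S >= 1 / 4%:R * max_indep M f
          & (t <= C * (#|T| * maxn (rank M) 1))%N]].
Proof.
(* 49 = 15 * 3 + 4: at most [15 * #|T|] per iteration, at most [3 * maxn (rank M) 1] iterations, and
   4 for the final comparison of the twins. The proper inclusion in [non_monotone] makes [T]
   non-empty, which absorbs the constants. *)
exists 49%N => R T M f [X0 [Y0 [/properP[_ [x0 _ _]] _]]] f_ge0 f_sub.
have T_gt0 : (0 < #|T|)%N by apply/card_gt0P; exists x0.
have loopok := body_terminates M f (start T).
split=> //.
  have [t1 [S loopS]] := loop_exists loopok.
  have [t2 [best pick]] := @pick_max_total R _ [:: (S.1, f S.1); (S.2, f S.2)] isT.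
  exists (t1 + (1 + (1 + (t2 + 0))))%N, best.1; exists t1, (1 + (1 + (t2 + 0)))%N, S.
  split=> //; exists 1%N, (1 + (t2 + 0))%N, (f S.1); split=> //.
  exists 1%N, (t2 + 0)%N, (f S.2); split=> //.
  by exists t2, 0%N, best.
move=> t S' [t1 [t2 [S [loopS tail ->]]]].
have feas_step S1 t0 S2 :
    feasible M S1 -> twin_greedy_body M f S1 t0 (inl S2) -> feasible M S2.
  by move=> feas1 /body_spec[_ [j [e [[ea _ _] ->]]]]; apply: feasible_insert.
have [S2 [iS _] [t0 /body_spec[_ [eqS stop]]]] :=
  loop_invariant feas_step (feasible_start M) loopS.
subst S2.
move: tail => [ta [tb [v1 [[-> ->] [tc [td [v2 [[-> ->] tail ->]]] ->]]]]].
case: tail => [te [tf [best [[-> bestc bestmax] [-> ->] ->]]]].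
have [bestS1 bestS2 ibest] :
    [/\ f S.1 <= f best.1, f S.2 <= f best.1 & best.1 \in indep M].
  have le1 := bestmax _ (mem_head _ _); have le2 := bestmax _ (mem_last _ _).
  move: bestc le1 le2; rewrite !inE => /orP[]/eqP -> /= le1 le2; split=> //.
  - exact: (iS false).
  - exact: (iS true).
split=> //.
  suff : max_indep M f <= 4%:R * f best.1 by lra.
  have opt O : O \in indep M -> f O <= 4%:R * f best.1.
    move=> iO.
    (* The algorithm does not know [O]: for each [O] the invariant is followed along the same
       execution. *)
    have charge_step S1 t3 S2 : (exists B d, charging M f O S1 B d) ->
        twin_greedy_body M f S1 t3 (inl S2) -> exists B d, charging M f O S2 B d.
      move=> [B [d ch]] /body_spec[_ [j [e [gr ->]]]].
      exact: charging_step ch gr.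
    have [S2 [B [d ch]] [t3 /body_spec[_ [eqS _]]]] := loop_invariant charge_step
      (ex_intro _ _ (ex_intro _ _ (charging_start iO f_ge0))) loopS.
    subst S2; have := charging_final f_sub iO ch stop f_ge0; lra.
  (* The default value [f set0] is covered by taking [O] empty. *)
  rewrite /max_indep; apply/bigmax_leP; split=> [|O]; last exact: opt.
  exact/opt/indep0.
have body_time S1 t3 r : twin_greedy_body M f S1 t3 r -> (t3 <= 12 * #|T| + 3)%N.
  by move/body_spec=> [].
pose mu (S1 : twins T) := (2 * rank M - #|S1.1 :|: S1.2|)%N.
have mu_step S1 t3 S2 : feasible M S1 -> twin_greedy_body M f S1 t3 (inl S2) ->
    (mu S2 < mu S1)%N.
  (* The rank bound is taken after the insertion, so that the truncated subtraction in [mu]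
     decreases strictly. *)
  move=> feas1 body12; have := card_feasible (feas_step _ _ _ feas1 body12).
  case/body_spec: body12 => _ [j [e [[ea _ _] ->]]].
  by rewrite /mu (card_insert_twins ea); lia.
have := loop_time feas_step body_time mu_step (feasible_start M) loopS.
have le_mu : ((mu (start T)).+1 <= 3 * maxn (rank M) 1)%N by rewrite /mu; lia.
have le_body : (12 * #|T| + 3 <= 15 * #|T|)%N.
  by rewrite (_ : 15 = 12 + 3)%N // mulnDl leq_add2l leq_pmulr.
move=> le_t1; have := leq_trans le_t1 (leq_mul le_body le_mu).
have : (0 < #|T| * maxn (rank M) 1)%N by rewrite muln_gt0 T_gt0 leq_maxr.
rewrite mulnACA /=; set K := (#|T| * _)%N; lia.
Qed.
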